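(* Let $n\ge 4$ be even, let $f:E^{n+1}_0\to\{0,1\}$ be given by $f(x_0,\ldots,x_n)=\sum_{i=0}^{n}\sum_{j=1}^{\lfloor n/4\rfloor}x_i x_{i+j}$ (modulo 2, indices modulo $n+1$), and let $(G,* )$ be a commutative group (finite or infinite). Define the $n$-quasigroup $Q_f^{(G,* )}$ on the set $G\times Z_2^2$ by $$Q_f^{(G,* )}([w_1,z_1],\ldots,[w_n,z_n])=[\,w_1*\ldots*w_n,\ Q_{0,f}(z_1,\ldots,z_n)\,],\qquad w_i\in G,\ z_i\in Z_2^2.$$ Then $Q_f^{(G,* )}$ and its retracts inherit all the reducibility properties of $Q_{0,f}$ and its retracts: for every $A\subset\{0,\ldots,n\}$ with $1<|A|<n$, $Q_f^{(G,* )}$ is $A$-reducible if and only if $Q_{0,f}$ is $A$-reducible; and similarly, the retract of $Q_f^{(G,* )}$ obtained by fixing the variables with indices in a set $I$ to values $[w_i,z_i]$, $i\in I$, has the same reducibility properties as the retract of $Q_{0,f}$ obtained by fixing the variables with indices in $I$ to the values $z_i$, $i\in I$. Consequently, for every even $n\ge4$ and every $r>0$ there exists an irreducible $n$-quasigroup of order $4r$ all of whose $(n-1)$-ary retracts (those obtained by fixing one variable) are reducible; moreover, there exists an irreducible $n$-quasigroup of order $4r$ such that each of its $(n-1)$-ary retracts is $(i,j)$-reducible.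
   Context: An $n$-ary operation $Q:\Sigma^n\to\Sigma$ ($\Sigma$ nonempty) is an $n$-ary quasigroup ($n$-quasigroup) of order $|\Sigma|$ if in $z_0=Q(z_1,\ldots,z_n)$ any $n$ of the elements $z_0,\ldots,z_n$ uniquely determine the remaining one. Write $Q\langle z_0,\ldots,z_n\rangle$ for the predicate $z_0=Q(z_1,\ldots,z_n)$. Retracts: fixing the values of $l\le n$ of the variables $z_0,\ldots,z_n$ in the predicate $Q\langle z_0,\ldots,z_n\rangle$ gives an $(n-l+1)$-ary predicate, which corresponds to an $(n-l)$-quasigroup, called a retract of $Q$. (The variable $z_0$ may also be fixed; the remaining variables are taken in their natural order, renumbered from $0$.) Reducibility: an $n$-quasigroup $Q$ is $A$-reducible, where $A=\{a_1,\ldots,a_k\}\subseteq\{0,\ldots,n\}$ has complement $\{b_1,\ldots,b_{n-k+1}\}$ in $\{0,\ldots,n\}$, if there are a $k$-quasigroup $Q'$ and an $(n-k+1)$-quasigroup $Q''$ on $\Sigma$ with $$Q\langle z_0,\ldots,z_n\rangle\iff Q'(z_{a_1},\ldots,z_{a_k})=Q''(z_{b_1},\ldots,z_{b_{n-k+1}}).$$ $Q$ is (permutably) reducible if it is $A$-reducible for some $A\subset\{0,\ldots,n\}$ with $1<|A|<n$; otherwise it is irreducible. $Q$ is called $(i,j)$-reducible if it is $\{i,\ldots,i+j-1\}$-reducible for some $i\in\{1,\ldots,n\}$ and $j\in\{2,\ldots,n-1\}$ with $i+j-1\le n$ (so $i,j$ may depend on the quasigroup). For an $m$-ary retract the same definitions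 apply with $m$ in place of $n$. The quasigroup $Q_{0,f}$: all arithmetic on $\{0,1\}$ is modulo 2, and $E^{n+1}_0=\{(x_0,\ldots,x_n)\in\{0,1\}^{n+1}: x_0+\ldots+x_n=0\}$. $Q_{0,f}$ is the $n$-quasigroup of order 4 on $Z_2^2$ (elements written $[x,y]$) defined by $$Q_{0,f}\langle[x_0,y_0],\ldots,[x_n,y_n]\rangle\iff x_0+\ldots+x_n=0\ \text{ and }\ y_0+\ldots+y_n=f(x_0,\ldots,x_n).$$ *)

(* Defs.v *)
From HB Require Import structures.
From mathcomp Require Import all_boot all_order all_algebra.
From mathcomp Require boolp.

Set Implicit Arguments.
Unset Strict Implicit.
Unset Printing Implicit Defensive.

Import GRing.Theory.
Local Open Scope ring_scope.

Definition operation (n : nat) (S : Type) : Type := {ffun 'I_n -> S} -> S.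

(* The predicate Q<z_0, ..., z_n>, i.e. z_0 = Q(z_1, ..., z_n). *)
Definition graph (n : nat) (S : Type) (Q : operation n S)
    (z : {ffun 'I_n.+1 -> S}) : Prop :=
  z ord0 = Q [ffun i => z (lift ord0 i)].

Definition update (n : nat) (S : Type) (z : {ffun 'I_n -> S}) (i : 'I_n)
    (s : S) : {ffun 'I_n -> S} :=
  [ffun j => if j == i then s else z j].

Definition quasigroup (n : nat) (S : Type) (Q : operation n S) : Prop :=
  forall (i : 'I_n.+1) (z : {ffun 'I_n.+1 -> S}),
    exists! s : S, graph Q (update z i s).

(* (z_{a_1}, ..., z_{a_k}) for A = {a_1 < ... < a_k}. *)
Definition subfamily (n : nat) (S : Type) (A : {set 'I_n})
    (z : {ffun 'I_n -> S}) : {ffun 'I_#|A| -> S} :=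
  [ffun j => z (enum_val j)].

Definition A_reducible (n : nat) (S : Type) (Q : operation n S)
    (A : {set 'I_n.+1}) : Prop :=
  exists (Q' : operation #|A| S) (Q'' : operation #|~: A| S),
    [/\ quasigroup Q', quasigroup Q''
      & forall z : {ffun 'I_n.+1 -> S},
          graph Q z <-> Q' (subfamily A z) = Q'' (subfamily (~: A) z)].

Definition reducible (n : nat) (S : Type) (Q : operation n S) : Prop :=
  exists2 A : {set 'I_n.+1}, (1 < #|A| < n)%N & A_reducible Q A.

Definition irreducible (n : nat) (S : Type) (Q : operation n S) : Prop :=
  ~ reducible Q.

(* The indices i and j are existentially quantified: they may depend on Q. *)
Definition ij_reducible (n : nat) (S : Type) (Q : operation n S) : Prop :=
  exists i j : nat,
    [/\ (1 <= i <= n)%N, (2 <= j <= n - 1)%N, (i + j - 1 <= n)%N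
      & A_reducible Q [set k : 'I_n.+1 | (i <= k <= i + j - 1)%N]].

(* The j-th free variable, in increasing order, when those indexed by I are  *)
(* fixed; meaningful when #|~: I| = m.+1.                                    *)
Definition free_var (n m : nat) (I : {set 'I_n.+1}) (j : 'I_m.+1) : 'I_n.+1 :=
  nth ord0 (enum (~: I)) j.

(* R is the m-ary operation given by fixing in Q<z_0, ..., z_n> the          *)
(* variables z_i, i \in I, to the values a i; a is irrelevant outside I, and *)
(* 0 \in I is allowed.  When Q is a quasigroup and m + #|I| = n, such an R   *)
(* exists, is unique, and is a quasigroup: see retract_exists,               *)
(* retract_unique and retract_quasigroup below.                              *)
Definition is_retract (n m : nat) (S : Type) (Q : operation n S)
    (I : {set 'I_n.+1}) (a : 'I_n.+1 -> S) (R : operation m S) : Prop :=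
  (m + #|I|)%N = n /\
  forall z : {ffun 'I_n.+1 -> S}, (forall i, i \in I -> z i = a i) ->
    graph Q z <-> graph R [ffun j => z (free_var I j)].

(* The range 1 < #|A| < n covers every A that occurs in reducible and        *)
(* ij_reducible.                                                             *)
Definition same_reducibility (n : nat) (S T : Type)
    (Q : operation n S) (P : operation n T) : Prop :=
  forall A : {set 'I_n.+1}, (1 < #|A| < n)%N ->
    A_reducible Q A <-> A_reducible P A.

Notation Z22 := ('F_2 * 'F_2)%type.

(* Only the values of f at points with zero coordinate sum matter, since     *)
(* the first coordinate of the result is the sum of the first coordinates of *)
(* the arguments; see graph_Q0 for the defining predicate.                   *)
Definition Q0 (n : nat) (f : {ffun 'I_n.+1 -> 'F_2} -> 'F_2) :
    operation n Z22 :=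
  fun z =>
    let x0 := \sum_(i < n) (z i).1 in
    let x : {ffun 'I_n.+1 -> 'F_2} :=
      [ffun i => if unlift ord0 i is Some j then (z j).1 else x0] in
    (x0, f x + \sum_(i < n) (z i).2).

Definition f_cyc (n : nat) (x : {ffun 'I_n.+1 -> 'F_2}) : 'F_2 :=
  \sum_(i < n.+1) \sum_(1 <= j < (n %/ 4).+1) x i * x (inZp (i + j)).
Arguments f_cyc n x : clear implicits.

Definition QG (n : nat) (G : zmodType)
    (f : {ffun 'I_n.+1 -> 'F_2} -> 'F_2) : operation n (G * Z22) :=
  fun u => (\sum_(i < n) (u i).1, Q0 f [ffun i => (u i).2]).
Arguments QG {n} G f u.

Lemma F2_addrr (a : 'F_2) : a + a = 0.
Proof. by case: a => [[|[|k]] h] //; apply/val_inj. Qed.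

Lemma F2_eq_add (a b : 'F_2) : a = b <-> a + b = 0.
Proof.
split=> [->|]; first exact: F2_addrr.
by move=> h; rewrite -[a]addr0 -(F2_addrr b) addrA h add0r.
Qed.

Lemma graph_Q0 (n : nat) (f : {ffun 'I_n.+1 -> 'F_2} -> 'F_2)
    (z : {ffun 'I_n.+1 -> Z22}) :
  graph (Q0 f) z <->
    \sum_(i < n.+1) (z i).1 = 0
    /\ \sum_(i < n.+1) (z i).2 = f [ffun i => (z i).1].
Proof.
rewrite /graph /Q0 !big_ord_recl /=.
under eq_bigr do rewrite ffunE.
under [X in (_, _ + X)]eq_bigr do rewrite ffunE.
set s := \sum_(i < n) _; set t := \sum_(i < n) _.
set x := (X in f X).
have ex : (z ord0).1 = s -> x = [ffun i => (z i).1].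
  move=> e; apply/ffunP=> i; rewrite !ffunE.
  by case: unliftP => [j ->|->]; rewrite ?ffunE.
case ez: (z ord0) => [x0 y0] /=; rewrite ez /= in ex.
split=> [[e1 e2]|[/(F2_eq_add _ _).2 e1 e2]].
  split; first by move/F2_eq_add: e1.
  by rewrite e2 -addrA F2_addrr addr0 ex.
by rewrite (ex e1) -e2 -addrA F2_addrr addr0 e1.
Qed.

Section Retracts.

Variables (n m : nat) (S : Type) (I : {set 'I_n.+1}) (a : 'I_n.+1 -> S).
Hypothesis eqn : (m + #|I|)%N = n.

Let extend (y : {ffun 'I_m.+1 -> S}) : {ffun 'I_n.+1 -> S} :=
  [ffun k => if k \in I then a k else y (inord (index k (enum (~: I))))].

Let card_free : size (enum (~: I)) = m.+1.
Proof.
rewrite -cardE cardsCs setCK card_ord; apply/eqP.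
by rewrite -(eqn_add2r #|I|) subnK ?addSn ?eqn // ltnW // ltnS -[leqRHS]eqn leq_addl.
Qed.

Let free_var_out (j : 'I_m.+1) : free_var I j \notin I.
Proof. by rewrite -in_setC -mem_enum mem_nth ?card_free. Qed.

Let index_free (j : 'I_m.+1) :
  inord (index (free_var I j) (enum (~: I))) = j.
Proof. by rewrite index_uniq ?card_free ?enum_uniq // inord_val. Qed.

Let extend_in y i : i \in I -> extend y i = a i.
Proof. by rewrite ffunE => ->. Qed.

Let extendK y : [ffun j => extend y (free_var I j)] = y.
Proof.
by apply/ffunP=> j; rewrite !ffunE (negPf (free_var_out j)) index_free.
Qed.

Let extend_update y j s :
  extend (update y j s) = update (extend y) (free_var I j) s.
Proof.
apply/ffunP=> k; rewrite !ffunE; case: (boolP (k \in I)) => kI.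
  by case: eqP => // e; rewrite e (negPf (free_var_out j)) in kI.
have kE : k \in enum (~: I) by rewrite mem_enum in_setC.
have eqk : free_var I (inord (index k (enum (~: I))) : 'I_m.+1) = k.
  by rewrite /free_var inordK ?nth_index // -card_free index_mem.
congr (if _ then _ else _).
by apply/eqP/eqP => [<-|->] //; rewrite index_free.
Qed.

Lemma retract_quasigroup (Q : operation n S) (R : operation m S) :
  quasigroup Q -> is_retract Q I a R -> quasigroup R.
Proof.
move=> qQ [_ rR] i y; have [s [hs us]] := qQ (free_var I i) (extend y).
have E t : graph Q (update (extend y) (free_var I i) t)
    <-> graph R (update y i t).
  by rewrite -extend_update -{2}[update y i t]extendK; apply/rR/extend_in.
by exists s; split=> [|t /E /us //]; apply/E.
Qed.

Lemma retract_exists (Q : operation n S) :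
  quasigroup Q -> exists R : operation m S, is_retract Q I a R.
Proof.
move=> qQ.
pose w (y : {ffun 'I_m -> S}) (s : S) : {ffun 'I_m.+1 -> S} :=
  [ffun j => if unlift ord0 j is Some k then y k else s].
have H y : exists s, forall t, graph Q (extend (w y t)) <-> t = s.
  have [s [hs us]] := qQ (free_var I (ord0 : 'I_m.+1)) (extend (w y (a ord0))).
  have E t : update (extend (w y (a ord0))) (free_var I (ord0 : 'I_m.+1)) t
      = extend (w y t).
    rewrite -extend_update; congr extend; apply/ffunP=> j; rewrite !ffunE.
    by case: unliftP => [k ->|->]; rewrite ?eqxx // eq_sym (negPf (neq_lift _ _)).
  by exists s => t; rewrite -E; split=> [/us|->].
have [R hR] := boolp.choice H; exists R; split=> // z za.
pose y : {ffun 'I_m.+1 -> S} := [ffun j => z (free_var I j)].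
have ez : z = extend (w [ffun j => y (lift ord0 j)] (y ord0)).
  apply/ffunP=> k; rewrite ffunE; case: (boolP (k \in I)) => [/za //|kI].
  have kE : k \in enum (~: I) by rewrite mem_enum in_setC.
  set j := inord _; have <- : free_var I (j : 'I_m.+1) = k.
    by rewrite /free_var inordK ?nth_index // -card_free index_mem.
  by rewrite ffunE; case: unliftP => [l ->|->]; rewrite !ffunE.
by rewrite {1}ez hR.
Qed.

Lemma retract_unique (Q : operation n S) (R R' : operation m S) :
  is_retract Q I a R -> is_retract Q I a R' -> forall y, R y = R' y.
Proof.
move=> [_ rR] [_ rR'] y.
pose y' : {ffun 'I_m.+1 -> S} :=
  [ffun j => if unlift ord0 j is Some k then y k else R y].
have ey : [ffun i => y' (lift ord0 i)] = y.
  by apply/ffunP=> i; rewrite !ffunE liftK.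
have e0 : y' ord0 = R y by rewrite ffunE unlift_none.
have : graph R y' by rewrite /graph ey e0.
rewrite -{1}[y']extendK => /(rR _ (@extend_in y')) /(rR' _ (@extend_in y')).
by rewrite extendK /graph ey e0.
Qed.

End Retracts.

(* Main.v *)
(* An n-quasigroup Q is A-reducible exactly when its graph is rectangular for
   A: three corners of a rectangle z_A, w_A by z_B, w_B in the graph force the
   fourth.  The group equation w_0 = w_1 + ... + w_n is rectangular for every A,
   so the rectangularity of the graph of QG, or of a retract, is that of Q0.

   For Q0 with a quadratic f, the fourth corner is governed by the alternating
   sum of f over the rectangle, a bilinear form in the A-part and the B-part of
   the difference of two opposite corners, whose matrix is the adjacency matrix
   of the graph of f; both parts have even weight.  Hence Q0 is A-reducible iff
   every 2 x 2 submatrix of the A x B block has even sum.  In the half graph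
   (a < b adjacent iff a is odd and b is even) no nontrivial A has this
   property, but once a vertex t is fixed, its two cyclic neighbours become
   twins (or antitwins), and twins split off as a reducing pair. *)
Require Import Defs.
From HB Require Import structures.
From mathcomp Require Import all_boot all_order all_algebra.
From mathcomp Require boolp.
From mathcomp Require Import zify.

Set Implicit Arguments.
Unset Strict Implicit.
Unset Printing Implicit Defensive.

Import GRing.Theory.
Local Open Scope ring_scope.

(** * Reducibility as rectangularity of the graph *)

Definition mix (n : nat) (S : Type) (A : {set 'I_n}) (z w : {ffun 'I_n -> S}) :
    {ffun 'I_n -> S} :=
  [ffun i => if i \in A then z i else w i].

(* P is the graph of an equality between a function of z_A and a function of *)
(* the other coordinates.  The corners are z, mix A z w, mix A w z and w.    *)
Definition rectangular (n : nat) (S : Type) (A : {set 'I_n})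
    (P : {ffun 'I_n -> S} -> Prop) : Prop :=
  forall z w, P z -> P (mix A z w) -> P (mix A w z) -> P w.

Lemma mixC (n : nat) (S : Type) (A : {set 'I_n}) (z w : {ffun 'I_n -> S}) :
  mix (~: A) z w = mix A w z.
Proof. by apply/ffunP=> i; rewrite !ffunE in_setC; case: (i \in A). Qed.

Lemma rectangularC (n : nat) (S : Type) (A : {set 'I_n})
    (P : {ffun 'I_n -> S} -> Prop) :
  rectangular (~: A) P -> rectangular A P.
Proof.
by move=> h z w Pz Pzw Pwz; apply: (h z w) => //; rewrite mixC.
Qed.

(** In the graph of an operation the coordinate at [ord0] is determined as the value of [Q], so only
    solvability in each argument remains to be checked. *)
Lemma quasigroup_op (n : nat) (S : Type) (Q : operation n S) :
  (forall (j : 'I_n) (y : {ffun 'I_n -> S}) (t : S),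
     exists! s : S, Q (update y j s) = t) -> quasigroup Q.
Proof.
move=> h i z; case: (unliftP ord0 i) => [j ->|->].
  have [s [hs us]] := h j [ffun k => z (lift ord0 k)] (z ord0).
  have E t : graph Q (update z (lift ord0 j) t) <->
      Q (update [ffun k => z (lift ord0 k)] j t) = z ord0.
    rewrite /graph ffunE (negPf (neq_lift _ _)).
    have -> : [ffun k => update z (lift ord0 j) t (lift ord0 k)]
        = update [ffun k => z (lift ord0 k)] j t.
      by apply/ffunP=> k; rewrite !ffunE (inj_eq lift_inj).
    by split.
  by exists s; split=> [|t /E /us]; [apply/E|].
exists (Q [ffun k => z (lift ord0 k)]).
have E t : [ffun k => update z ord0 t (lift ord0 k)]
    = [ffun k => z (lift ord0 k)].
  by apply/ffunP=> k; rewrite !ffunE eq_sym (negPf (neq_lift _ _)).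
by rewrite /graph; split=> [|t]; rewrite E !ffunE eqxx // => ->.
Qed.

Section Rectangles.

Variables (n : nat) (S : Type) (Q : operation n S) (A : {set 'I_n.+1}).

(** With B the complement of [A], three corners chain together:
    [Q'(w_A) = Q''(z_B) = Q'(z_A) = Q''(w_B)]. *)
Lemma reducible_rectangular : A_reducible Q A -> rectangular A (graph Q).
Proof.
case=> Q' [Q'' [_ _ h]] z w /h e1 /h e2 /h e3; apply/h.
have E u v : subfamily A (mix A u v) = subfamily A u.
  by apply/ffunP=> i; rewrite !ffunE enum_valP.
have F u v : subfamily (~: A) (mix A u v) = subfamily (~: A) v.
  apply/ffunP=> i; rewrite !ffunE; case: ifP => // iA.
  by have := enum_valP i; rewrite in_setC iA.
by rewrite !E !F in e2 e3; rewrite e3 -e1.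
Qed.

Hypothesis qQ : quasigroup Q.
Variables (c : S) (a0 b0 : 'I_n.+1).
Hypotheses (a0A : a0 \in A) (b0A : b0 \in ~: A).

(** [Q'] labels [z_A] by the value at [b0] that completes it when all other coordinates outside [A]
    equal [c]. [Q''] labels the remaining coordinates by the label of an A-part compatible with
    them, found by varying [a0] alone. *)
Lemma rectangular_reducible : rectangular A (graph Q) -> A_reducible Q A.
Proof.
move=> rQ.
have H (p : 'I_n.+1 * {ffun 'I_n.+1 -> S}) :
    exists t, forall s, graph Q (update p.2 p.1 s) <-> s = t.
  have [s [hs us]] := qQ p.1 p.2.
  by exists s => t; split=> [/us|->].
have [sol solP] := boolp.choice H.
have b0nA : b0 \in A = false by apply/negbTE; rewrite -in_setC.
pose d : {ffun 'I_n.+1 -> S} := [ffun => c].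
pose q' z := sol (b0, mix A z d).
have q'P z s : q' z = s <-> graph Q (update (mix A z d) b0 s).
  by rewrite (solP (b0, _)); split=> [<-|->].
(* [psi] inverts the map sending [s] to [q' (update d a0 s)]. An equation on [q''] thus becomes a
   single graph equation, [q''P], which can be solved in each coordinate outside [A]. *)
pose psi t := sol (a0, update d b0 t).
have psiP s t : q' (update d a0 s) = t <-> s = psi t.
  rewrite q'P -(solP (a0, _)) /=.
  suff -> : update (mix A (update d a0 s) d) b0 t = update (update d b0 t) a0 s by [].
  apply/ffunP=> k; rewrite !ffunE; case: (eqVneq k b0) => [->|kb].
    by case: eqP => // e; move: a0A; rewrite -e b0nA.
  by case: (eqVneq k a0) => [->|ka]; rewrite ?a0A //; case: ifP.
pose tau z := sol (a0, mix A d z).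
have tauP z s : tau z = s <-> graph Q (update (mix A d z) a0 s).
  by rewrite (solP (a0, _)); split=> [<-|->].
pose q'' z := q' (update d a0 (tau z)).
have q''P z t : q'' z = t <-> graph Q (update (mix A d z) a0 (psi t)).
  by rewrite psiP tauP.
(* Outside their index sets these extensions take filler values, which [mix] discards. *)
pose ext' (y : {ffun 'I_#|A| -> S}) : {ffun 'I_n.+1 -> S} :=
  [ffun k => y (enum_rank_in a0A k)].
pose ext'' (y : {ffun 'I_#|~: A| -> S}) : {ffun 'I_n.+1 -> S} :=
  [ffun k => y (enum_rank_in b0A k)].
exists (fun y => q' (ext' y)), (fun y => q'' (ext'' y)); split.
- apply: quasigroup_op => j y t.
  have [s [hs us]] := qQ (enum_val j) (update (mix A (ext' y) d) b0 t).
  have E r : q' (ext' (update y j r)) = t <->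
      graph Q (update (update (mix A (ext' y) d) b0 t) (enum_val j) r).
    rewrite q'P.
    suff -> : update (mix A (ext' (update y j r)) d) b0 t
      = update (update (mix A (ext' y) d) b0 t) (enum_val j) r by [].
    apply/ffunP=> k; rewrite !ffunE.
    case: (eqVneq k b0) => [->|kb].
      by case: eqP => // e; have := enum_valP j; rewrite -e b0nA.
    case: ifP => kA; last by case: eqP => // e; rewrite e enum_valP in kA.
    congr (if _ then _ else _); apply/eqP/eqP => [<-|->].
      by rewrite enum_rankK_in.
    by rewrite enum_valK_in.
  by exists s; split=> [|r /E /us]; [apply/E|].
- apply: quasigroup_op => j y t.
  have [s [hs us]] := qQ (enum_val j) (update (mix A d (ext'' y)) a0 (psi t)).
  have jA : enum_val j \in A = false.
    by apply/negbTE; rewrite -in_setC enum_valP.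
  have E r : q'' (ext'' (update y j r)) = t <->
      graph Q (update (update (mix A d (ext'' y)) a0 (psi t)) (enum_val j) r).
    rewrite q''P.
    suff -> : update (mix A d (ext'' (update y j r))) a0 (psi t)
      = update (update (mix A d (ext'' y)) a0 (psi t)) (enum_val j) r by [].
    apply/ffunP=> k; rewrite !ffunE.
    case: (eqVneq k a0) => [->|ka].
      by case: eqP => // e; rewrite -e a0A in jA.
    case: ifP => kA; first by case: eqP => // e; rewrite -e kA in jA.
    have kC : k \in ~: A by rewrite in_setC kA.
    congr (if _ then _ else _); apply/eqP/eqP => [<-|->].
      by rewrite enum_rankK_in.
    by rewrite enum_valK_in.
  by exists s; split=> [|r /E /us]; [apply/E|].
move=> z.
have [-> ->] : q' (ext' (subfamily A z)) = q' z
    /\ q'' (ext'' (subfamily (~: A) z)) = q'' z.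
  split; [congr (sol (_, _)) | congr (q' (update _ _ (sol (_, _))))];
    apply/ffunP=> k; rewrite !ffunE; case: ifP => // kA.
    by rewrite enum_rankK_in.
  by rewrite enum_rankK_in // in_setC kA.
(* [mix A x z] and [mix A z y] lie in the graph by construction, so rectangularity puts [z] in the
   graph exactly when [mix A x y] is there; the latter says [q' x = q' z], and [q' x] is [q'' z]. *)
pose x := update d a0 (tau z).
pose y := update d b0 (q' z).
have xB : mix A x z = update (mix A d z) a0 (tau z).
  apply/ffunP=> k; rewrite !ffunE; case: ifP => kA //.
  by case: eqP => // e; rewrite e a0A in kA.
have g1 : graph Q (mix A x z) by rewrite xB; apply/tauP.
have E u s : mix A u (update d b0 s) = update (mix A u d) b0 s.
  apply/ffunP=> k; rewrite !ffunE; case: ifP => kA //.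
  by case: eqP => // e; rewrite e b0nA in kA.
have g2 : graph Q (mix A z y) by rewrite E; apply/q'P.
have M u v w v' : mix A (mix A u v) (mix A v' w) = mix A u w.
  by apply/ffunP=> k; rewrite !ffunE; case: (k \in A).
have mid u : mix A u u = u.
  by apply/ffunP=> k; rewrite !ffunE; case: (k \in A).
split=> [gz | e].
  rewrite /q''; symmetry; apply/q'P; rewrite -/x -E -/y.
  apply: (rQ (mix A z z)); rewrite ?M ?mid //.
have g3 : graph Q (mix A x y).
  by rewrite /y e E; apply/q'P.
by have := rQ (mix A x y) (mix A z z); rewrite !M mid; apply.
Qed.

End Rectangles.

(** * Retracts in the original coordinates *)

(** The graph of a retract, kept on all [n.+1] coordinates: retracts over different alphabets can
    then be compared without renumbering. *)
Definition fixing (n : nat) (S : Type) (I : {set 'I_n.+1}) (a : 'I_n.+1 -> S)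
    (Q : operation n S) (z : {ffun 'I_n.+1 -> S}) : Prop :=
  (forall i, i \in I -> z i = a i) /\ graph Q z.

Section FreeVariables.

Variables (n m : nat) (I : {set 'I_n.+1}).
Hypothesis eqn : (m + #|I|)%N = n.

Lemma size_free : size (enum (~: I)) = m.+1.
Proof.
rewrite -cardE; apply/eqP; rewrite -(eqn_add2r #|I|) addnC cardsC card_ord.
by rewrite addSn eqn.
Qed.

Lemma free_varN (j : 'I_m.+1) : free_var I j \notin I.
Proof. by rewrite -in_setC -mem_enum mem_nth ?size_free. Qed.

Lemma free_var_inj : injective (@free_var n m I).
Proof.
move=> j k /eqP; rewrite nth_uniq ?size_free ?enum_uniq // => /eqP.
exact: val_inj.
Qed.

Lemma extension_exists (S : Type) (a : 'I_n.+1 -> S) (y : {ffun 'I_m.+1 -> S}) :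
  exists z : {ffun 'I_n.+1 -> S},
    (forall i, i \in I -> z i = a i) /\ [ffun j => z (free_var I j)] = y.
Proof.
exists [ffun k => if k \in I then a k
                  else y (inord (index k (enum (~: I))))].
split=> [i iI|]; first by rewrite ffunE iI.
apply/ffunP=> j; rewrite !ffunE (negPf (free_varN j)).
by rewrite index_uniq ?size_free ?enum_uniq // inord_val.
Qed.

End FreeVariables.

Lemma mix_free (n m : nat) (S : Type) (I : {set 'I_n.+1}) (A : {set 'I_m.+1})
    (z w : {ffun 'I_n.+1 -> S}) :
  (m + #|I|)%N = n ->
  [ffun j => mix (@free_var n m I @: A) z w (free_var I j)]
    = mix A [ffun j => z (free_var I j)] [ffun j => w (free_var I j)].
Proof.
move=> eqn; apply/ffunP=> j; rewrite !ffunE mem_imset //.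
exact: free_var_inj.
Qed.

(** The image of [A] avoids [I], so on [I] the corner [mix _ z w] coincides with [w], and all
    corners carry the values [a] there. Conversely, corners of the retract extend by [a]. *)
Lemma retract_rectangular (n m : nat) (S : Type) (Q : operation n S)
    (I : {set 'I_n.+1}) (a : 'I_n.+1 -> S) (R : operation m S)
    (A : {set 'I_m.+1}) :
  is_retract Q I a R ->
  rectangular A (graph R) <-> rectangular (@free_var n m I @: A) (fixing I a Q).
Proof.
move=> [eqn rR]; split=> h z w.
  move=> [za /rR gz] [za1 /rR gz1] [za2 /rR gz2].
  have wa i : i \in I -> w i = a i.
    move=> iI; have := za1 i iI; rewrite ffunE; case: imsetP => // -[j _ e].
    by have := free_varN eqn j; rewrite -e iI.
  split=> //; apply/(rR _ wa).
  apply: h (gz za) _ _; rewrite -mix_free //; [exact: gz1 | exact: gz2].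
have [x [xa <-]] := extension_exists eqn a z.
have [y [ya <-]] := extension_exists eqn a w.
rewrite -!mix_free // => /(rR _ xa) g1.
have ma (u v : {ffun 'I_n.+1 -> S}) : (forall i, i \in I -> u i = a i) ->
    (forall i, i \in I -> v i = a i) -> forall i, i \in I ->
    mix (@free_var n m I @: A) u v i = a i.
  by move=> hu hv i iI; rewrite ffunE; case: ifP => _; [apply: hu | apply: hv].
move=> /(rR _ (ma _ _ xa ya)) g2 /(rR _ (ma _ _ ya xa)) g3.
apply/(rR _ ya); apply: (proj2 (h x y _ _ _)); split=> //; exact: ma.
Qed.

(** Makes [Q] one of its own retracts, so that statements on retracts cover [Q] itself. *)
Lemma retract_set0 (n : nat) (S : Type) (Q : operation n S)
    (a : 'I_n.+1 -> S) : is_retract Q set0 a Q.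
Proof.
split=> [|z _]; first by rewrite cards0 addn0.
suff -> : [ffun j => z (free_var set0 (j : 'I_n.+1))] = z by [].
apply/ffunP=> j; rewrite ffunE /free_var setC0.
have -> : enum [set: 'I_n.+1] = enum 'I_n.+1.
  by apply: eq_enum => i; rewrite in_setT.
by rewrite nth_ord_enum.
Qed.

(** * The group component of [QG] *)

Section Group.

Variables (n : nat) (G : zmodType).

(** Its vanishing is the equation [w_0 = w_1 + ... + w_n], written additively in [w]. *)
Definition signed_sum (w : {ffun 'I_n.+1 -> G}) : G :=
  \sum_(i < n.+1) (if i == ord0 then - w i else w i).

Lemma signed_sum_mix (A : {set 'I_n.+1}) (z w : {ffun 'I_n.+1 -> G}) :
  signed_sum (mix A z w) + signed_sum (mix A w z)
    = signed_sum z + signed_sum w.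
Proof.
rewrite -!big_split; apply: eq_bigr => i _; rewrite !ffunE.
by case: (i \in A); rewrite //= addrC.
Qed.

Lemma signed_sum_update (w : {ffun 'I_n.+1 -> G}) (i : 'I_n.+1) :
  exists s, forall t, signed_sum (update w i t) = 0 <-> t = s.
Proof.
pose r := \sum_(k < n.+1 | k != i) (if k == ord0 then - w k else w k).
have E t : signed_sum (update w i t) = (if i == ord0 then - t else t) + r.
  rewrite /signed_sum (bigD1 i) //= !ffunE eqxx; congr (_ + _).
  by apply: eq_bigr => k /negPf ki; rewrite !ffunE ki.
exists (if i == ord0 then r else - r) => t; rewrite E; case: ifP => _.
  by rewrite addrC; split=> [/subr0_eq|->] //; rewrite subrr.
by split=> [/eqP|->]; rewrite ?addNr // addr_eq0 => /eqP.
Qed.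

Lemma graph_QG (f : {ffun 'I_n.+1 -> 'F_2} -> 'F_2)
    (z : {ffun 'I_n.+1 -> G * Z22}) :
  graph (QG G f) z <->
    signed_sum [ffun i => (z i).1] = 0 /\ graph (Q0 f) [ffun i => (z i).2].
Proof.
rewrite /graph /QG /signed_sum big_ord_recl /= !ffunE.
have -> : [ffun i => ([ffun i0 => z (lift ord0 i0)] i).2]
    = [ffun i => [ffun i0 => (z i0).2] (lift ord0 i)].
  by apply/ffunP=> i; rewrite !ffunE.
under eq_bigr do rewrite ffunE.
under [X in _ <-> _ + X = 0 /\ _]eq_bigr do rewrite ffunE.
case: (z ord0) => w0 z0 /=; split=> [[-> ->]|[+ ->]]; first by rewrite addNr.
by move/eqP; rewrite addrC subr_eq0 => /eqP ->.
Qed.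

(** The first equation gives the first coordinate at [i]; the argument of [f] is then known, and the
    second equation gives the second coordinate. The 0 in [(t.1, 0)] is a placeholder, since [f]
    sees only first coordinates. *)
Lemma quasigroup_Q0 (f : {ffun 'I_n.+1 -> 'F_2} -> 'F_2) : quasigroup (Q0 f).
Proof.
move=> i z.
have E t : graph (Q0 f) (update z i t) <->
    t.1 = \sum_(k < n.+1 | k != i) (z k).1 /\
    t.2 = \sum_(k < n.+1 | k != i) (z k).2
      + f [ffun k => (update z i (t.1, 0) k).1].
  rewrite graph_Q0 (bigD1 i) //= [X in _ /\ X = _](bigD1 i) //= ffunE eqxx.
  have -> : [ffun k => (update z i t k).1] = [ffun k => (update z i (t.1, 0) k).1].
    by apply/ffunP=> k; rewrite !ffunE; case: ifP.
  have e (p : Z22 -> 'F_2) : \sum_(k < n.+1 | k != i) p (update z i t k)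
      = \sum_(k < n.+1 | k != i) p (z k).
    by apply: eq_bigr => k /negPf ki; rewrite ffunE ki.
  rewrite (e fst) (e snd).
  set s1 := \sum_(k | _) _; set s2 := \sum_(k | _) _.
  split=> [[/(F2_eq_add _ _).2 h1 h2]|[/F2_eq_add h1 h2]]; split=> //.
    by rewrite -h2 addrCA F2_addrr addr0.
  by rewrite h2 addrAC F2_addrr add0r.
set s1 := \sum_(k | _) _ in E; set s2 := \sum_(k | _) _ in E.
exists (s1, s2 + f [ffun k => (update z i (s1, 0) k).1]).
split=> [|[t1 t2] /E /= [-> ->]] //; exact/E.
Qed.

Lemma quasigroup_QG (f : {ffun 'I_n.+1 -> 'F_2} -> 'F_2) :
  quasigroup (QG G f).
Proof.
move=> i z.
have [s hs] := signed_sum_update [ffun k => (z k).1] i.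
have [t [ht ut]] := quasigroup_Q0 f i [ffun k => (z k).2].
have E p : graph (QG G f) (update z i p) <->
    p.1 = s /\ graph (Q0 f) (update [ffun k => (z k).2] i p.2).
  rewrite graph_QG -hs.
  suff [-> ->] : [ffun k => (update z i p k).1] = update [ffun k => (z k).1] i p.1
      /\ [ffun k => (update z i p k).2] = update [ffun k => (z k).2] i p.2 by [].
  by split; apply/ffunP=> k; rewrite !ffunE; case: ifP.
exists (s, t); split=> [|[s' t'] /E /= [-> /ut ->]] //; exact/E.
Qed.

Lemma mix_map (S T : Type) (p : S -> T) (A : {set 'I_n.+1})
    (z w : {ffun 'I_n.+1 -> S}) :
  [ffun i => p (mix A z w i)] = mix A [ffun i => p (z i)] [ffun i => p (w i)].
Proof. by apply/ffunP=> i; rewrite !ffunE; case: ifP. Qed.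

(** From [QG] to [Q0], all corners are lifted with one common group part. From [Q0] to [QG],
    [signed_sum_mix] makes the group equation of the fourth corner follow from the other three. *)
Lemma rectangular_QG (f : {ffun 'I_n.+1 -> 'F_2} -> 'F_2)
    (I A : {set 'I_n.+1}) (a : 'I_n.+1 -> G * Z22) (j : 'I_n.+1) :
  j \notin I ->
  rectangular A (fixing I a (QG G f)) <->
  rectangular A (fixing I (fun i => (a i).2) (Q0 f)).
Proof.
move=> jI; split=> h z w.
  (* The common group part is that of [a], corrected at the free index [j] to satisfy the group
     equation; on [I] it still agrees with [a]. *)
  have [s /(_ s)[_ /(_ erefl) w0]] := signed_sum_update [ffun i => (a i).1] j.
  set g := update _ _ _ in w0.
  pose L (u : {ffun 'I_n.+1 -> Z22}) : {ffun 'I_n.+1 -> G * Z22} :=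
    [ffun i => (g i, u i)].
  have LP u : fixing I a (QG G f) (L u) <-> fixing I (fun i => (a i).2) (Q0 f) u.
    rewrite /fixing graph_QG.
    have [-> ->] : [ffun i => (L u i).1] = g /\ [ffun i => (L u i).2] = u.
      by split; apply/ffunP=> i; rewrite !ffunE.
    split=> [[h1 [_ h2]]|[h1 h2]]; split=> //.
      by move=> i /h1 <-; rewrite ffunE.
    move=> i iI; rewrite !ffunE h1 //; case: eqP => [e|_]; last by case: (a i).
    by rewrite e (negPf jI) in iI.
  have Lmix u v : L (mix A u v) = mix A (L u) (L v).
    by apply/ffunP=> i; rewrite !ffunE; case: (i \in A).
  by rewrite -!LP !Lmix; apply: h.
have S (u : {ffun 'I_n.+1 -> G * Z22}) : fixing I a (QG G f) u ->
    fixing I (fun i => (a i).2) (Q0 f) [ffun i => (u i).2].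
  by move=> [h1 /graph_QG[_ h2]]; split=> // i /h1 ea; rewrite ffunE ea.
move=> gz gzw gwz.
have [_ gw] := h _ [ffun i => (w i).2] (S _ gz)
  ltac:(rewrite -mix_map; exact: S gzw) ltac:(rewrite -mix_map; exact: S gwz).
case: gz gzw gwz => [za /graph_QG[z0 _]] [m1 /graph_QG[zw0 _]] [m2 /graph_QG[wz0 _]].
split; first by move=> i iI; move: (m1 i iI) (m2 i iI); rewrite !ffunE; case: ifP.
apply/graph_QG; split=> //; move: zw0 wz0; rewrite !mix_map => zw0 wz0.
have := signed_sum_mix A [ffun i => (z i).1] [ffun i => (w i).1].
by rewrite zw0 wz0 z0 !add0r.
Qed.

End Group.

(** * Transfer of reducibility between [QG] and [Q0] *)

Lemma card_between (n : nat) (A : {set 'I_n.+1}) : (1 < #|A| < n)%N ->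
  (1 < #|A| /\ 1 < #|~: A|)%N.
Proof.
move=> /andP[A1 An]; split=> //; have := cardsC A; rewrite card_ord => e.
by rewrite -(ltn_add2l #|A|) e addn1 ltnS.
Qed.

Lemma A_reducibleP (n : nat) (S : Type) (Q : operation n S) (c : S)
    (A : {set 'I_n.+1}) : quasigroup Q -> (1 < #|A| < n)%N ->
  A_reducible Q A <-> rectangular A (graph Q).
Proof.
move=> qQ /card_between[/ltnW/card_gt0P[a0 a0A] /ltnW/card_gt0P[b0 b0A]].
split; first exact: reducible_rectangular.
exact (rectangular_reducible qQ c a0A b0A).
Qed.

Lemma retract_QG_reducible (n m : nat) (G : zmodType)
    (f : {ffun 'I_n.+1 -> 'F_2} -> 'F_2) (I : {set 'I_n.+1})
    (a : 'I_n.+1 -> G * Z22) (R : operation m (G * Z22)) (A : {set 'I_m.+1}) :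
  is_retract (QG G f) I a R -> (1 < #|A| < m)%N ->
  A_reducible R A <->
  rectangular (@free_var n m I @: A) (fixing I (fun i => (a i).2) (Q0 f)).
Proof.
move=> rR mA.
have qR := retract_quasigroup (proj1 rR) (@quasigroup_QG n G f) rR.
rewrite (A_reducibleP (0, (0, 0)) qR mA) (retract_rectangular _ rR).
exact: rectangular_QG (free_varN (proj1 rR) ord0).
Qed.

(** Both sides amount to the rectangularity of the same relation, [fixing] applied to [Q0]. *)
Lemma retract_QG_same (n m : nat) (G : zmodType)
    (f : {ffun 'I_n.+1 -> 'F_2} -> 'F_2) (I : {set 'I_n.+1})
    (a : 'I_n.+1 -> G * Z22) (R : operation m (G * Z22)) (R0 : operation m Z22) :
  is_retract (QG G f) I a R -> is_retract (Q0 f) I (fun i => (a i).2) R0 ->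
  same_reducibility R R0.
Proof.
move=> rR rR0 A mA; rewrite (retract_QG_reducible rR mA).
have qR0 := retract_quasigroup (proj1 rR0) (quasigroup_Q0 f) rR0.
by rewrite (A_reducibleP (0, 0) qR0 mA) (retract_rectangular _ rR0).
Qed.

(** * The half graph and the alternating sum over a rectangle *)

(* For n even, reindexing the circulant graph of f_cyc n by i -> 4 i modulo   *)
(* n.+1, switching vertices and possibly complementing gives this half graph; *)
(* switching and complementing preserve the parities of                       *)
(* adj a b + adj a b' + adj a' b + adj a' b', which decide reducibility.      *)
(* The reindexing makes the two twins left by fixing the i-th variable, i + s *)
(* and i - s with 4 s = 1 or -1 modulo n.+1, the neighbours of i.             *)
Definition edge (a b : nat) : bool := [&& a < b, odd a & ~~ odd b]%N.

Definition adj (a b : nat) : bool := edge a b || edge b a.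

Definition half_form (n : nat) (x : {ffun 'I_n.+1 -> 'F_2}) : 'F_2 :=
  \sum_(a < n.+1) \sum_(b < n.+1) (edge a b)%:R * (x a * x b).

Lemma adjE (a b : nat) : (adj a b)%:R = (edge a b)%:R + (edge b a)%:R :> 'F_2.
Proof. by rewrite /adj /edge; case: ltngtP => // _; rewrite ?addr0 ?add0r ?orbF. Qed.

Lemma F2_cases (x : 'F_2) : x = 0 \/ x = 1.
Proof.
by case: x => [[|[|k]] h] //; [left|right]; apply: val_inj.
Qed.

Lemma natr_addb (a b : bool) : (a (+) b)%:R = a%:R + b%:R :> 'F_2.
Proof. by case: a; case: b; rewrite ?addr0 ?add0r ?F2_addrr. Qed.

Section FourSum.

Variables (n : nat) (A : {set 'I_n.+1}) (x u : {ffun 'I_n.+1 -> 'F_2}).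

Let p a := if a \in A then x a + u a else 0.
Let q a := if a \in A then 0 else x a + u a.

(** For a pair on one side of [A] each product occurs twice and cancels; for a pair split by [A] the
    four products add up to [(x a + u a) * (x b + u b)]. Exchanging the sums for [edge b a] gathers
    both orientations into [adj]. *)
Lemma half_form_mix :
  half_form x + half_form (mix A x u) + half_form (mix A u x) + half_form u
    = \sum_(a < n.+1) \sum_(b < n.+1) (adj a b)%:R * (p a * q b).
Proof.
under [RHS]eq_bigr => a _ do
  (under eq_bigr => b _ do rewrite adjE mulrDl; rewrite big_split).
rewrite big_split /= [X in _ = _ + X]exchange_big /= -!big_split.
apply: eq_bigr => a _; rewrite -!big_split; apply: eq_bigr => b _ /=.
rewrite -!mulrDr; congr (_ * _); rewrite /p /q !ffunE.
by case: (a \in A); case: (b \in A);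
  case: (F2_cases (x a)) => ->; case: (F2_cases (x b)) => ->;
  case: (F2_cases (u a)) => ->; case: (F2_cases (u b)) => ->;
  apply/val_inj.
Qed.

(** [p] is the sum of the two corners [x] and [mix A u x], each of even weight. *)
Lemma sum_mixl : \sum_i x i = 0 -> \sum_i mix A u x i = 0 -> \sum_i p i = 0.
Proof.
move=> e1 e2; transitivity (\sum_i x i + \sum_i mix A u x i).
  rewrite -big_split; apply: eq_bigr => i _; rewrite /p ffunE /=.
  by case: (i \in A); rewrite ?F2_addrr.
by rewrite e1 e2 addr0.
Qed.

Lemma sum_mixr : \sum_i x i = 0 -> \sum_i mix A x u i = 0 -> \sum_i q i = 0.
Proof.
move=> e1 e2; transitivity (\sum_i x i + \sum_i mix A x u i).
  rewrite -big_split; apply: eq_bigr => i _; rewrite /q ffunE /=.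
  by case: (i \in A); rewrite ?F2_addrr.
by rewrite e1 e2 addr0.
Qed.

End FourSum.

(** Even weight forces [p u = p v], so the bilinear form is [p u] times the sum of
    [(adj u k + adj v k) * q k], that is, [p u * kappa] times the sum of [q], which is zero. [kappa]
    is false for twins and true for antitwins. *)
Lemma rectangular_twins (n : nat) (A : {set 'I_n.+1}) (t u v : 'I_n.+1)
    (kappa : bool) (a : 'I_n.+1 -> Z22) :
  u != v -> u != t -> v != t ->
  (forall k : 'I_n.+1, k \notin [:: u; v; t] -> adj u k (+) adj v k = kappa) ->
  (forall k, k != t -> (k \in A) = (k == u) || (k == v)) ->
  rectangular A (fixing [set t] a (Q0 (@half_form n))).
Proof.
move=> uv ut vt twin memA z w [za /graph_Q0[z1 z2]] [ma /graph_Q0[m1 m2]].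
move=> [ma' /graph_Q0[m1' m2']].
have wa i : i \in [set t] -> w i = a i.
  by move=> it; move: (ma i it) (ma' i it); rewrite !ffunE; case: ifP.
split=> //; apply/graph_Q0.
have S (p : Z22 -> 'F_2) : \sum_i p (w i) = \sum_i p (z i)
    + \sum_i p (mix A z w i) + \sum_i p (mix A w z i).
  rewrite -!big_split; apply: eq_bigr => i _; rewrite !ffunE /=.
  by case: ifP => _; rewrite ?F2_addrr ?add0r // addrAC F2_addrr add0r.
rewrite (S fst) (S snd) z1 m1 m1' z2 m2 m2' !addr0; split=> //.
apply/F2_eq_add; rewrite !mix_map half_form_mix.
set x := [ffun i => (z i).1]; set y := [ffun i => (w i).1].
set p := fun i : 'I_n.+1 => if i \in A then x i + y i else 0.
set q := fun i : 'I_n.+1 => if i \in A then 0 else x i + y i.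
(* [t] has the same value at all corners, so [p] and [q] both vanish there, on whichever side of [A]
   it lies. *)
have xt : x t + y t = 0 by rewrite !ffunE za ?set11 // wa ?set11 // F2_addrr.
have m (r : {ffun 'I_n.+1 -> Z22}) : \sum_i (r i).1 = \sum_i [ffun i => (r i).1] i.
  by apply: eq_bigr => i _; rewrite ffunE.
have sp : \sum_i p i = 0.
  by apply: sum_mixl; rewrite -?mix_map -m.
have sq : \sum_i q i = 0.
  by apply: sum_mixr; rewrite -?mix_map -m.
have pE (F : 'I_n.+1 -> 'F_2) : \sum_i p i * F i = p u * (F u + F v).
  have p0 i : (i != u) && (i != v) -> p i = 0.
    move=> /andP[iu iv]; rewrite /p; case: (eqVneq i t) => [->|it].
      by rewrite xt; case: ifP.
    by rewrite memA // (negPf iu) (negPf iv).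
  have E (F' : 'I_n.+1 -> 'F_2) : \sum_i p i * F' i = p u * F' u + p v * F' v.
    rewrite (bigD1 u) // (bigD1 v) 1?eq_sym //= big1 ?addr0 //.
    by move=> i /p0 ->; rewrite mul0r.
  have e : p u = p v.
    apply/F2_eq_add; transitivity (\sum_i p i * 1).
      by rewrite (E (fun=> 1)) !mulr1.
    by rewrite -mulr_suml sp mul0r.
  by rewrite E -e mulrDr.
under eq_bigr => i _ do
  (under eq_bigr => b _ do rewrite mulrCA; rewrite -mulr_sumr).
rewrite pE -big_split /=; set r := \sum_i _.
suff -> : r = kappa%:R * \sum_i q i by rewrite sq !mulr0.
rewrite mulr_sumr; apply: eq_bigr => k _; rewrite -mulrDl -natr_addb.
rewrite -/(q k); case: (boolP (k \in [:: u; v; t])) => [|/twin -> //].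
suff qk : k \in [:: u; v; t] -> q k = 0 by move/qk ->; rewrite !mulr0.
rewrite !inE /q => /or3P[] /eqP ->; rewrite ?xt ?if_same //.
  by rewrite memA // eqxx.
by rewrite memA // eqxx orbT.
Qed.

(** Tests the rectangle between 0 and the indicator of [a, a', b, b']: its alternating sum is
    exactly this four-term sum of adjacencies. *)
Lemma rectangular_half_xor (n : nat) (A : {set 'I_n.+1}) (a a' b b' : 'I_n.+1) :
  rectangular A (graph (Q0 (@half_form n))) ->
  a \in A -> a' \in A -> b \notin A -> b' \notin A ->
  adj a b (+) adj a b' (+) adj a' b (+) adj a' b' = false.
Proof.
move=> rQ aA a'A bA b'A.
pose x : {ffun 'I_n.+1 -> 'F_2} := [ffun => 0].
pose u : {ffun 'I_n.+1 -> 'F_2} := [ffun i =>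
  (i == a)%:R + (i == a')%:R + (i == b)%:R + (i == b')%:R].
have vA c d : c \in A -> d \notin A -> (c == d = false) * (d == c = false).
  by move=> cA dA; rewrite eq_sym; split; apply: contraNF dA => /eqP ->.
have sum_delta (c : 'I_n.+1) (F : 'I_n.+1 -> 'F_2) :
    \sum_i (i == c)%:R * F i = F c.
  rewrite (bigD1 c) //= eqxx mul1r big1 ?addr0 // => i /negPf ->.
  by rewrite mul0r.
have sum_delta1 (c : 'I_n.+1) : \sum_i (i == c)%:R = 1 :> 'F_2.
  rewrite -[RHS](sum_delta c (fun=> 1)).
  by apply: eq_bigr => i _; rewrite mulr1.
have uA i : (if i \in A then x i + u i else 0) = (i == a)%:R + (i == a')%:R.
  rewrite !ffunE add0r; case: ifP => [iA|/negbT iA].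
    by rewrite (vA i b iA bA) (vA i b' iA b'A) !addr0.
  by rewrite (vA a i aA iA) (vA a' i a'A iA) addr0.
have uB i : (if i \in A then 0 else x i + u i) = (i == b)%:R + (i == b')%:R.
  rewrite !ffunE add0r; case: ifP => [iA|/negbT iA].
    by rewrite (vA i b iA bA) (vA i b' iA b'A) addr0.
  by rewrite (vA a i aA iA) (vA a' i a'A iA) !add0r.
have f0 : half_form x = 0.
  by apply: big1 => i _; apply: big1 => j _; rewrite !ffunE !mulr0.
pose z : {ffun 'I_n.+1 -> Z22} := [ffun => (0, 0)].
(* The second coordinates put the two intermediate corners in the graph: the value of the form at
   [mix A u x] is stored at [a], inside [A], and that at [mix A x u] at [b], outside. *)
pose w : {ffun 'I_n.+1 -> Z22} := [ffun i => (u i,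
  (i == a)%:R * half_form (mix A u x) + (i == b)%:R * half_form (mix A x u))].
have zx : [ffun i => (z i).1] = x by apply/ffunP=> i; rewrite !ffunE.
have wu : [ffun i => (w i).1] = u by apply/ffunP=> i; rewrite !ffunE.
have gz : graph (Q0 (@half_form n)) z.
  by apply/graph_Q0; rewrite zx f0; split; apply: big1 => i _; rewrite ffunE.
have gzw : graph (Q0 (@half_form n)) (mix A z w).
  apply/graph_Q0; rewrite mix_map zx wu; split.
    transitivity (\sum_i ((i == b)%:R + (i == b')%:R : 'F_2)).
      by apply: eq_bigr => i _; rewrite -uB !ffunE add0r; case: ifP.
    by rewrite big_split /= !sum_delta1 F2_addrr.
  rewrite -[RHS](sum_delta b (fun=> _)); apply: eq_bigr => i _; rewrite !ffunE.
  case: ifP => [iA|/negbT iA] /=; first by rewrite (vA i b iA bA) mul0r.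
  by rewrite (vA a i aA iA) mul0r add0r.
have gwz : graph (Q0 (@half_form n)) (mix A w z).
  apply/graph_Q0; rewrite mix_map zx wu; split.
    transitivity (\sum_i ((i == a)%:R + (i == a')%:R : 'F_2)).
      by apply: eq_bigr => i _; rewrite -uA !ffunE add0r; case: ifP.
    by rewrite big_split /= !sum_delta1 F2_addrr.
  rewrite -[RHS](sum_delta a (fun=> _)); apply: eq_bigr => i _; rewrite !ffunE.
  case: ifP => [iA|/negbT iA] /=; last by rewrite (vA a i aA iA) mul0r.
  by rewrite (vA i b iA bA) mul0r addr0.
have /graph_Q0[_] := rQ z w gz gzw gwz; rewrite wu => gw.
have := half_form_mix A x u; rewrite f0 add0r -gw.
have -> : \sum_i (w i).2 = half_form (mix A x u) + half_form (mix A u x).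
  transitivity (\sum_i ((i == a)%:R * half_form (mix A u x)
      + (i == b)%:R * half_form (mix A x u))).
    by apply: eq_bigr => i _; rewrite ffunE.
  by rewrite big_split /= (sum_delta a (fun=> _)) (sum_delta b (fun=> _)) addrC.
rewrite F2_addrr => e.
suff : (adj a b (+) adj a b' (+) adj a' b (+) adj a' b')%:R = 0 :> 'F_2.
  by case: (_ (+) adj a' b').
rewrite e; symmetry.
transitivity (\sum_i ((i == a)%:R + (i == a')%:R)
    * ((adj i b)%:R + (adj i b')%:R : 'F_2)).
  apply: eq_bigr => i _.
  rewrite -(sum_delta b (fun j => (adj i j)%:R)).
  rewrite -(sum_delta b' (fun j => (adj i j)%:R)) -big_split mulr_sumr.
  apply: eq_bigr => j _.
  by rewrite uA uB /= -mulrDl [LHS]mulrC -mulrA.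
under eq_bigr => i _ do rewrite mulrDl.
rewrite big_split /= (sum_delta a (fun i => (adj i b)%:R + (adj i b')%:R)).
rewrite (sum_delta a' (fun i => (adj i b)%:R + (adj i b')%:R)).
by rewrite !natr_addb !addrA.
Qed.

(** * Irreducibility for the half graph *)

(** [t] and [t.+2] have equal parity: exactly one is adjacent to [t.+1], while any [s] outside the
    window sees both alike. *)
Lemma adj_isolated (t s : nat) :
  s != t.+1 -> s != t -> s != t.+2 ->
  adj t.+1 t (+) adj t.+1 t.+2 (+) adj s t (+) adj s t.+2.
Proof.
rewrite /adj /edge /= negbK; case: (odd t); case: (odd s);
  rewrite /= ?andbF ?andbT ?orbF; lia.
Qed.

(** Exactly one of the four pairs is adjacent: the odd one of [t, t.+1] with the even one of
    [t.+2, t.+3]. *)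
Lemma adj_runs (t : nat) :
  adj t t.+2 (+) adj t t.+3 (+) adj t.+1 t.+2 (+) adj t.+1 t.+3.
Proof.
rewrite /adj /edge /= !negbK.
by case: (odd t); rewrite /= ?andbF ?andbT ?orbF; lia.
Qed.

(* The windows BAB and AABB of consecutive indices are both excluded, which   *)
(* leaves possible class changes only next to the endpoints 0 and n.          *)
Lemma balanced_partition_trivial (n : nat) (c : nat -> bool) :
  (4 <= n)%N -> ~~ odd n ->
  (forall k, (k <= n)%N -> exists2 s, (s <= n)%N & (s != k) && (c s == c k)) ->
  (forall a a' b b', (a <= n)%N -> (a' <= n)%N -> (b <= n)%N -> (b' <= n)%N ->
     c a = c a' -> c b = c b' -> c a != c b ->
     adj a b (+) adj a b' (+) adj a' b (+) adj a' b' = false) ->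
  forall k, (k <= n)%N -> c k = c 0%N.
Proof.
move=> n4 on mate bal.
have isolated t : (t.+2 <= n)%N -> c t = c t.+2 -> c t.+1 = c t.+2.
  move=> tn e; apply/eqP/negPn/negP => ne.
  have [s sn /andP[st /eqP cs]] := mate t.+1 (ltnW tn).
  have sr r : c r = c t.+2 -> s != r.
    by move=> er; apply: contraNneq ne => es; rewrite -cs es er.
  have := adj_isolated st (sr _ e) (sr _ erefl); rewrite bal //.
  - exact: ltnW.
  - by rewrite ltnW // ltnW.
  by rewrite e.
have inner t : (t.+3 <= n)%N -> c t.+1 = c t.+2.
  move=> tn; apply/eqP/negPn/negP => ne.
  have e1 : c t = c t.+1.
    case: (eqVneq (c t) (c t.+2)) => [e|].
      by rewrite (isolated t) ?eqxx // ltnW in ne.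
    by move: ne; case: (c t); case: (c t.+1); case: (c t.+2).
  have e2 : c t.+2 = c t.+3.
    case: (eqVneq (c t.+1) (c t.+3)) => [e|]; first exact: isolated.
    by move: ne; case: (c t.+1); case: (c t.+2); case: (c t.+3).
  by have := adj_runs t; rewrite bal ?e1 //; clear -tn; lia.
have const t : (t.+1 < n)%N -> c t.+1 = c 1%N.
  elim: t => [|t IH] tn; first by [].
  by rewrite -(inner t tn); apply: IH; apply: ltnW.
have c01 : c 0%N = c 1%N.
  apply/eqP/negPn/negP => ne.
  have [s sn /andP[s0 /eqP cs]] := mate 0%N ltac:(lia).
  have es : s = n.
    apply/eqP/negPn/negP => sn'; case: s sn s0 cs sn' => // s sn _ cs sn'.
    by rewrite -cs const ?eqxx // ltn_neqAle sn' in ne.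
  rewrite es in cs.
  (* Now [0] and [n] form a class against [1, ..., n - 1]. Among the pairs between [0, n] and [1, 2]
     only [1, n] is adjacent, as [n] is even. *)
  have := bal 0%N n 1%N 2%N ltac:(lia) ltac:(lia) ltac:(lia) ltac:(lia) (esym cs).
  have -> : c 2%N = c 1%N by apply: const; exact: leq_trans n4.
  move=> /(_ erefl ne); rewrite /adj /edge (negPf on) /=; clear -n4; lia.
have const0 t : (t < n)%N -> c t = c 0%N.
  by case: t => // t tn; rewrite c01 const.
move=> k; rewrite leq_eqVlt => /orP[/eqP ->|]; last exact: const0.
have [s sn /andP[sk /eqP <-]] := mate n (leqnn n).
by apply: const0; rewrite ltn_neqAle sk.
Qed.

Lemma half_irreducible (n : nat) (A : {set 'I_n.+1}) :
  (4 <= n)%N -> ~~ odd n -> (1 < #|A|)%N -> (1 < #|~: A|)%N ->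
  ~ rectangular A (graph (Q0 (@half_form n))).
Proof.
move=> n4 on A1 B1 rQ.
pose c k := (inord k : 'I_n.+1) \in A.
have cE (i : 'I_n.+1) : c i = (i \in A) by rewrite /c inord_val.
suff const k : (k <= n)%N -> c k = c 0%N.
  have /card_gt0P[a aA] := ltnW A1; have /card_gt0P[b bB] := ltnW B1.
  have := const a (leq_ord a); rewrite -(const b (leq_ord b)).
  by rewrite !cE aA; move: bB; rewrite in_setC => /negPf ->.
apply: balanced_partition_trivial => // {}k.
  rewrite -ltnS => kn; have cK := cE (Ordinal kn); rewrite /= in cK.
  have [B [kB B2 BE]] : exists B : {set 'I_n.+1}, [/\ Ordinal kn \in B, (1 < #|B|)%N
      & forall i, (i \in B) = (c i == c k)].
    case: (boolP (Ordinal kn \in A)) => kA.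
      by exists A; split=> // i; rewrite cE cK kA eqb_id.
    exists (~: A); split; rewrite ?in_setC // => i.
    by rewrite in_setC cE cK (negPf kA) eqbF_neg.
  have := B2; rewrite (cardsD1 (Ordinal kn)) kB ltnS => /card_gt0P[s].
  rewrite !inE -val_eqE /= => /andP[sk sB]; exists s; first by rewrite -ltnS.
  by rewrite sk -BE.
move=> a' b b' h1 h2 h3 h4; rewrite -ltnS in h1; rewrite -ltnS in h2.
rewrite -ltnS in h3; rewrite -ltnS in h4.
have e1 := cE (Ordinal h1); have e2 := cE (Ordinal h2).
have e3 := cE (Ordinal h3); have e4 := cE (Ordinal h4).
rewrite /= in e1 e2 e3 e4; rewrite e1 e2 e3 e4 => ea eb.
case: (boolP (Ordinal h1 \in A)) => aA; case: (boolP (Ordinal h3 \in A)) => bA //= _.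
  by apply: (rectangular_half_xor (a := Ordinal h1) (a' := Ordinal h2)
    (b := Ordinal h3) (b' := Ordinal h4) rQ); rewrite // -?ea -?eb.
(* Here the class of the first pair is the complement of [A], so the rectangle is transposed, using
   the symmetry of [adj]. *)
have := rectangular_half_xor (a := Ordinal h3) (a' := Ordinal h4)
    (b := Ordinal h1) (b' := Ordinal h2) rQ bA.
rewrite -eb -ea => /(_ bA aA aA) /=.
have adjC x y : adj x y = adj y x by rewrite /adj orbC.
by rewrite ![adj _ k]adjC ![adj _ a']adjC [_ (+) adj k b' in X in X -> _]addbAC.
Qed.

(** * One-variable retracts: twins and intervals *)

Lemma free_var1 (n m : nat) (t : 'I_n.+1) (j : 'I_m.+1) :
  m.+1 = n -> @free_var n m [set t] j = bump t j :> nat.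
Proof.
move=> mn; have eE : map val (enum (~: [set t])) = iota 0 t ++ iota t.+1 (n - t).
  have -> : enum (~: [set t]) = [seq i : 'I_n.+1 <- enum 'I_n.+1 | i != t :> nat].
    by rewrite enumT; apply: eq_filter => i; rewrite /= !inE.
  rewrite -(filter_map val (fun k => k != t :> nat)) val_enum_ord.
  have := ltn_ord t; move: (nat_of_ord t) => s sn.
  rewrite -(subnKC sn) addSnnS iotaD filter_cat add0n /= eqxx /=.
  rewrite subSS; congr (_ ++ _); apply/all_filterP/allP=> k;
    rewrite mem_iota => /andP[]; lia.
rewrite /free_var -[LHS](nth_map _ 0%N val); last first.
  rewrite -(size_map val) eE size_cat !size_iota; have := ltn_ord j; lia.
rewrite eE nth_cat size_iota /bump; case: (ltnP j t) => jt.
  by rewrite nth_iota // add0n.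
have jm := ltn_ord j; rewrite nth_iota.
  by rewrite addSn subnKC // jt.
by clear eE; lia.
Qed.

Lemma card_interval (m i j : nat) :
  (0 < i)%N -> (i + j <= m.+1)%N ->
  #|[set k : 'I_m.+1 | (i <= k <= i + j - 1)%N]| = j.
Proof.
move=> i0 ijm; pose g (l : 'I_j) : 'I_m.+1 := inord (i + l).
have gE l : g l = (i + l)%N :> nat.
  by rewrite inordK //; have := ltn_ord l; lia.
have g_inj : injective g.
  by move=> l l' /(congr1 val) /=; rewrite !gE => /addnI /val_inj.
rewrite -[RHS]card_ord -cardsT -(card_imset _ g_inj); apply: eq_card => k.
rewrite !inE; apply/idP/imsetP => [hk|[l _ ->]]; last first.
  by rewrite gE; have := ltn_ord l; lia.
have kj : (k - i < j)%N by lia.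
by exists (Ordinal kj) => //; apply: val_inj; rewrite /= gE /=; lia.
Qed.

Lemma half_retract_ij_reducible (n : nat) (G : zmodType) (t : 'I_n.+1)
    (a : 'I_n.+1 -> G * Z22) (R : operation n.-1 (G * Z22)) :
  (4 <= n)%N -> ~~ odd n -> is_retract (QG G (@half_form n)) [set t] a R ->
  ij_reducible R.
Proof.
move=> n4 on rR; have n0 : n.-1.+1 = n by rewrite prednK // (leq_trans _ n4).
(* [u] and [v] are the twins left by fixing [t], and [i, j] describe an interval of the renumbered
   variables. [co] tells whether this interval is the complement of the pair, needed when the pair
   contains the renumbered variable 0. *)
have key (i j u v : nat) (kappa co : bool) :
    [&& 1 <= i <= n.-1, 2 <= j <= n.-1 - 1 & i + j - 1 <= n.-1]%N ->
    [&& u != v, u != t, v != t, u <= n & v <= n]%N ->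
    (forall k, (k <= n)%N -> k != u -> k != v -> k != t ->
       adj u k (+) adj v k = kappa) ->
    (forall k, (k < n)%N -> (i <= k <= i + j - 1)%N
       = co (+) ((bump t k == u) || (bump t k == v))) ->
    ij_reducible R.
  move=> /and3P[hi hj hij] /and5P[uv ut vt un vn] twin memA.
  exists i, j; split=> //.
  set A := [set k | _].
  have cA : #|A| = j by apply: card_interval; lia.
  apply/(retract_QG_reducible rR); first by rewrite cA; lia.
  set B := _ @: A.
  have memB k : k != t -> (k \in B) = co (+) ((k == u :> nat) || (k == v :> nat)).
    move=> kt; have [l el] : exists l : 'I_n.-1.+1, free_var [set t] l = k.
      have kI : (unbump t k < n.-1.+1)%N.
        have := ltn_ord k; have := ltn_ord t; move: kt.
        by rewrite -val_eqE /unbump n0 /=; case: ltnP => /=; clear -n4; lia.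
      exists (Ordinal kI); apply: val_inj; rewrite /= free_var1 //=.
      by rewrite unbumpKcond val_eqE (negPf kt).
    rewrite -el mem_imset; last exact: free_var_inj (proj1 rR).
    by rewrite inE memA ?free_var1 // -{2}n0.
  have twins (C : {set 'I_n.+1}) :
      (forall k, k != t -> (k \in C) = (k == u :> nat) || (k == v :> nat)) ->
      rectangular C (fixing [set t] (fun i => (a i).2) (Q0 (@half_form n))).
    move=> memC.
    have iu : (inord u : 'I_n.+1) = u :> nat by rewrite inordK.
    have iv : (inord v : 'I_n.+1) = v :> nat by rewrite inordK.
    apply: (@rectangular_twins _ _ t (inord u) (inord v) kappa).
    - by rewrite -val_eqE /= iu iv.
    - by rewrite -val_eqE /= iu.
    - by rewrite -val_eqE /= iv.
    - move=> k; rewrite !inE -!val_eqE /= iu iv !negb_or => /and3P[].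
      by apply: twin; apply: leq_ord.
    by move=> k kt; rewrite memC // -!val_eqE /= iu iv.
  case: co memA memB => _ memB; last by apply: twins => k /memB.
  by apply: rectangularC; apply: twins => k kt; rewrite in_setC memB // negbK.
have tn := leq_ord t; move: (nat_of_ord t) tn key => s sn key; clear -n4 on sn key.
case: s sn key => [|[|s]] sn key.
(* [t = 0]: the neighbours [1] and [n] are antitwins, renumbered [0] and [n - 1]. *)
- apply: (key 1%N n.-2 1%N n true true); try lia.
    move=> r rn r1 rn' r0; rewrite /adj /edge (negPf on) /=.
    by case: (odd r); rewrite /= ?andbF ?andbT ?orbF; clear key; lia.
  by move=> r rn; rewrite /bump; clear key; lia.
(* [t = 1]: the neighbours [0] and [2] become [0] and [1]. *)
- apply: (key 2%N n.-2 0%N 2%N false true); try lia.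
    move=> r rn r0 r2 r1; rewrite /adj /edge /=.
    by case: (odd r); rewrite /= ?andbF ?andbT ?orbF; clear key; lia.
  by move=> r rn; rewrite /bump; clear key; lia.
case: (eqVneq s.+2 n) => [sn'|sn'].
  (* [t = n]: the cyclic neighbours [n - 1] and [0] keep their numbers. *)
  apply: (key 1%N n.-2 n.-1 0%N false true); try lia.
    move=> r rn r1 r0 rn'; rewrite /adj /edge -sn' /= in on rn rn' *.
    rewrite negbK in on; rewrite on.
    by case: (odd r); rewrite /= ?andbF ?andbT ?orbF; clear key; lia.
  by move=> r rn; rewrite /bump; clear key; lia.
(* Inner [t = s.+2]: its neighbours become the consecutive [s.+1] and [s.+2], an interval of length
   2. *)
apply: (key s.+1 2%N s.+1 s.+3 false false); try lia.
  move=> r rn r1 r3 r2; rewrite /adj /edge /= !negbK.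
  by case: (odd r); case: (odd s); rewrite /= ?andbF ?andbT ?orbF; clear key; lia.
by move=> r rn; rewrite /bump; clear key; lia.
Qed.

Lemma ij_reducible_reducible (n : nat) (S : Type) (Q : operation n S) :
  ij_reducible Q -> reducible Q.
Proof.
case=> i [j [/andP[i0 _] /andP[j2 jn] ijn rA]].
suff h A : A_reducible Q A -> #|A| = j -> reducible Q.
  by apply: h rA _; rewrite card_interval //; lia.
move=> {}rA cA; exists A => //; rewrite cA; lia.
Qed.

(** * Existence in order 4r *)

(** The witness is [QG] over the cyclic group of order [r], with [half_form] as the quadratic
    form. *)
Lemma half_order_4r (n r : nat) :
  (4 <= n)%N -> ~~ odd n -> (0 < r)%N ->
  exists (T : finType) (Q : operation n T),
    [/\ #|T| = (4 * r)%N, quasigroup Q, irreducible Q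
      & forall (I : {set 'I_n.+1}) (a : 'I_n.+1 -> T) (R : operation n.-1 T),
          is_retract Q I a R -> ij_reducible R].
Proof.
move=> n4 on r0; pose G : zmodType := 'I_r.-1.+1.
exists ('I_r.-1.+1 * Z22)%type, (QG G (@half_form n)); split.
- by rewrite !card_prod !card_ord prednK // mulnC.
- exact: quasigroup_QG.
- move=> [A A1n rA]; have [A1 B1] := card_between A1n.
  apply: (half_irreducible n4 on A1 B1).
  have := proj1 (retract_QG_reducible (retract_set0 _ (fun=> (0, (0, 0)))) A1n) rA.
  exact: (proj2 (retract_rectangular _ (retract_set0 _ _))).
move=> I a R rR.
have /eqP/cards1P[t It] : #|I| = 1%N by have := proj1 rR; lia.
by rewrite It in rR; apply: half_retract_ij_reducible rR.
Qed.

Local Close Scope ring_scope.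

Theorem mainTheorem2 (n : nat) (hn : 4 <= n) (hn_even : ~~ odd n) :
  (forall G : zmodType,
     [/\ quasigroup (Q0 (f_cyc n)),
         quasigroup (QG G (f_cyc n)),
         same_reducibility (QG G (f_cyc n)) (Q0 (f_cyc n))
       & forall (m : nat) (I : {set 'I_n.+1}) (a : 'I_n.+1 -> G * Z22)
           (R : operation m (G * Z22)) (R0 : operation m Z22),
           is_retract (QG G (f_cyc n)) I a R ->
           is_retract (Q0 (f_cyc n)) I (fun i => (a i).2) R0 ->
           same_reducibility R R0])
  /\
  (forall r : nat, 0 < r ->
     (exists (T : finType) (Q : operation n T),
        [/\ #|T| = 4 * r, quasigroup Q, irreducible Q
          & forall (I : {set 'I_n.+1}) (a : 'I_n.+1 -> T)
              (R : operation n.-1 T),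
              is_retract Q I a R -> reducible R])
     /\
     (exists (T : finType) (Q : operation n T),
        [/\ #|T| = 4 * r, quasigroup Q, irreducible Q
          & forall (I : {set 'I_n.+1}) (a : 'I_n.+1 -> T)
              (R : operation n.-1 T),
              is_retract Q I a R -> ij_reducible R])).
Proof.
split=> [G|r r0].
  split; [exact: quasigroup_Q0|exact: quasigroup_QG| |].
    exact: retract_QG_same (retract_set0 _ (fun=> (0, (0, 0)))%R) (retract_set0 _ _).
  by move=> m I a R R0; apply: retract_QG_same.
have [T [Q [cT qQ iQ rQ]]] := half_order_4r hn hn_even r0.
split; exists T, Q; split=> // I a R rR.
exact: ij_reducible_reducible (rQ I a R rR).
Qed.
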